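(* The non-reduced Lusternik-Schnirelmann category of the orbit space $\mathbb{C}P^2/\mathbb{Z}_2$ of the action of $\mathbb{Z}_2$ on the complex projective plane $\mathbb{C}P^2$ by conjugation is $2$: $$\mathrm{cat}(\mathbb{C}P^2/\mathbb{Z}_2)=2.$$
   Context: The action by conjugation is the involution $[a:b:c]\mapsto[\bar a:\bar b:\bar c]$ of $\mathbb{C}P^2$. $\mathrm{cat}(X)$ is the non-reduced Lusternik-Schnirelmann category: the minimal number $k$ such that $X$ can be covered by $k$ open sets each contractible to a point in $X$ (so $\mathrm{cat}$ of a point is $1$). *)

(* Defs.v *)
From HB Require Import structures.
From mathcomp Require Import all_boot all_order all_algebra generic_quotient.
From mathcomp Require Import all_classical all_reals all_analysis.
From mathcomp Require Import complex.

Set Implicit Arguments.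
Unset Strict Implicit.
Unset Printing Implicit Defensive.

Import Order.TTheory GRing.Theory Num.Theory.
Import numFieldNormedType.Exports.

Local Open Scope classical_set_scope.
Local Open Scope ring_scope.
Local Open Scope complex_scope.
Local Open Scope quotient_scope.

(* The topology on [R[i]] given by the complex modulus; [R[i]^o] carries it in
   the library, [R[i]] itself does not. *)
HB.instance Definition _ (R : rcfType) := PseudoPointedMetric.copy R[i] R[i]^o.

Section LusternikSchnirelmann.
Variables (R : realType) (X : topologicalType).

(* The inclusion of [U] into [X] is homotopic to a constant map; the homotopy
   [H] takes its values in [X], not necessarily in [U]. *)
Definition contractible_in (U : set X) : Prop :=
  exists (H : R * X -> X) (c : X),
    [/\ {within `[0%R, 1%R] `*` U, continuous H},
        (forall x, U x -> H (0, x) = x) &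
        (forall x, U x -> H (1, x) = c)].

Definition categorical_cover (k : nat) : Prop :=
  exists U : 'I_k -> set X,
    (forall i, open (U i) /\ contractible_in (U i)) /\
    \bigcup_(i in [set: 'I_k]) U i = [set: X].

(* Non-reduced: a point has category 1. [None] stands for the value infinity,
   when no finite categorical cover exists. *)
Definition LScat : option nat :=
  match pselect (exists k, `[< categorical_cover k >]) with
  | left h => Some (ex_minn h)
  | right _ => None
  end.

End LusternikSchnirelmann.

Section OrbitSpace.
Variables (X : topologicalType) (f : X -> X) (fK : involutive f).

(* The action of Z_2 on [X] whose generator acts by the involution [f]. *)
Definition Z2_act (g : 'Z_2) (x : X) : X := iter g f x.

Definition orbit_rel : rel X := fun x y => [exists g : 'Z_2, y == Z2_act g x].

Lemma orbit_relE x y : orbit_rel x y = (y == x) || (y == f x).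
Proof.
apply/existsP/orP => [[[[|[|//]] ? /= e]]|[e|e]]; first by left.
- by right.
- by exists 0.
- by exists 1.
Qed.

Lemma orbit_equivP : equiv_class_of orbit_rel.
Proof.
split=> [x|x y|y x z].
- by rewrite orbit_relE eqxx.
- by rewrite !orbit_relE (eq_sym x y) -(inv_eq fK) [f y == x]eq_sym.
- rewrite !orbit_relE => /orP[] /eqP -> // /orP[] /eqP ->.
    by rewrite eqxx orbT.
  by rewrite fK eqxx.
Qed.

Canonical orbit_equiv := EquivRelPack orbit_equivP.

Definition orbit_space := quotient_topology {eq_quot orbit_equiv}.

HB.instance Definition _ := Topological.on orbit_space.

End OrbitSpace.

Section ComplexProjectiveSpace.
Variables (R : realType) (n : nat).

Definition nonzero_vectors : set 'rV[R[i]]_n.+1 := [set v | v != 0].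

Definition proj_rel : rel nonzero_vectors := fun u v =>
  `[< exists2 l : R[i], l != 0 & set_val v = l *: set_val u >].

Lemma proj_equivP : equiv_class_of proj_rel.
Proof.
split=> [u|u v|v u w].
- by apply/asboolP; exists 1; rewrite ?oner_eq0 ?scale1r.
- apply/asboolP/asboolP => -[l l0 ->]; exists l^-1; rewrite ?invr_eq0//.
    by rewrite scalerA mulVf ?scale1r.
  by rewrite scalerA mulVf ?scale1r.
- move=> /asboolP[l l0 vE] /asboolP[m m0 wE]; apply/asboolP; exists (m * l).
    by rewrite mulf_neq0.
  by rewrite wE vE scalerA.
Qed.

Canonical proj_equiv := EquivRelPack proj_equivP.

(* The topology is the quotient topology from C^(n+1) minus the origin. *)
Definition CP := quotient_topology {eq_quot proj_equiv}.

HB.instance Definition _ := Quotient.on CP.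
HB.instance Definition _ := Topological.on CP.

Lemma conj_vec_subproof (v : nonzero_vectors) :
  map_mx conjc (set_val v) \in nonzero_vectors.
Proof.
have : set_val v != 0 by have := set_valP v.
rewrite inE /nonzero_vectors /=; apply: contra => /eqP/matrixP v0.
apply/eqP/matrixP => i j; apply/eqP; rewrite !mxE -conjc_eq0.
by have := v0 i j; rewrite !mxE => ->.
Qed.

Definition conj_vec (v : nonzero_vectors) : nonzero_vectors :=
  exist _ (map_mx conjc (set_val v)) (conj_vec_subproof v).

Definition conjCP : CP -> CP := fun x => \pi_CP (conj_vec (repr x)).

Lemma pi_conjCP : {morph \pi_CP : v / conj_vec v >-> conjCP v}.
Proof.
move=> v; rewrite /conjCP.
have /eqmodP/asboolP[l l0 e] : v = repr (\pi_CP v) %[mod_eq proj_equiv].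
  exact: esym (reprK _).
suff : conj_vec v = conj_vec (repr (\pi_CP v)) %[mod_eq proj_equiv] by [].
apply/eqmodP/asboolP; exists l^*%C; rewrite ?conjc_eq0//=.
by rewrite [LHS](congr1 (map_mx conjc) e) map_mxZ.
Qed.

Lemma conjCPK : involutive conjCP.
Proof.
elim/quotW => v; rewrite -(pi_conjCP v) -(pi_conjCP (conj_vec v)).
by congr (\pi_CP _); apply/val_inj/matrixP => i j; rewrite !mxE conjcK.
Qed.

End ComplexProjectiveSpace.

Definition CP2_mod_conj (R : realType) : topologicalType :=
  orbit_space (@conjCPK R 2).

(* Main.v *)
Require Import Defs.
From mathcomp Require Import all_boot all_classical all_reals all_analysis.
From mathcomp Require Import all_order all_algebra generic_quotient.
From mathcomp Require Import complex ring lra zify.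

(** The orbit space is a sphere of dimension 4. A point of the projective plane is
    a Hermitian matrix of rank one [z z^*] up to a positive factor, and conjugation
    changes the sign of its imaginary part. The real part [A] of this matrix is a
    real symmetric, positive semidefinite and singular 3 x 3 matrix; conversely it
    determines the imaginary part up to sign, and every such nonzero matrix arises.
    So the orbit space is the boundary of the convex set of positive semidefinite
    matrices of trace one, which has dimension 5. Instead of normalizing the trace,
    [A] is taken modulo scalar matrices and up to a positive factor. This loses
    nothing: a class modulo scalars contains exactly one singular positive
    semidefinite matrix, obtained by subtracting the least eigenvalue. The classes
    form a space of dimension 5 ([traceless_gram_surj], [traceless_gram_fiber],
    [traceless_gram_neq0]), and dividing by the norm gives a continuous bijection
    from the compact orbit space to the unit sphere of this space.

    A sphere has category 2 ([LScat_topological_sphere]). A sphere minus a point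
    contracts to the antipode of that point, so two open sets suffice. One would
    not: a contraction of the sphere would give a nowhere zero continuous map of
    the cube that is the identity on the boundary, against [poincare_miranda].

    The Poincare-Miranda theorem is derived from a parity argument on a fine grid
    of the cube ([common_sign_change_cube]). The signs of the coordinates of the map
    are labels with values modulo 2, and the cup product of their coboundaries is
    evaluated on the whole grid by means of Stokes' formula. The value is 1
    ([boxsum_cup]), so the product is nonzero on some small cube, where all the
    coordinates change sign. *)

Set Implicit Arguments.
Unset Strict Implicit.
Unset Printing Implicit Defensive.

Import Order.TTheory GRing.Theory Num.Theory.
Import numFieldNormedType.Exports.

Local Open Scope classical_set_scope.
Local Open Scope ring_scope.

(** * The cup product of labels on a grid *)

Section CubicalStokes.
Variable K : comNzRingType.

Implicit Types (p q r : nat -> nat) (ds fs : seq nat).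

Definition step (j : nat) p : nat -> nat := fun k => (p k + (k == j))%N.

Definition upd p (j x : nat) : nat -> nat := fun k => if k == j then x else p k.

Definition del (j : nat) ds := [seq k <- ds | k != j].

Lemma stepC j k p : step j (step k p) = step k (step j p).
Proof. by apply/funext => m; rewrite /step addnAC. Qed.

Lemma step_upd j p x : step j (upd p j x) = upd p j x.+1.
Proof.
by apply/funext => m; rewrite /step /upd; case: eqP => _; rewrite ?addn1 ?addn0.
Qed.

Lemma step_updC j k p x : k != j -> step j (upd p k x) = upd (step j p) k x.
Proof.
move=> kj; apply/funext => m; rewrite /step /upd.
by case: (eqVneq m k) => [->|//]; rewrite (negPf kj) addn0.
Qed.

Lemma updC j k p x y : k != j -> upd (upd p j x) k y = upd (upd p k y) j x.
Proof.
move=> kj; apply/funext => m; rewrite /upd.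
by case: (eqVneq m k) => [->|//]; rewrite (negPf kj).
Qed.

Lemma delC j k ds : del j (del k ds) = del k (del j ds).
Proof. by rewrite /del -!filter_predI; apply: eq_filter => m /=; rewrite andbC. Qed.

Lemma mem_del j k ds : (k \in del j ds) = (k != j) && (k \in ds).
Proof. by rewrite mem_filter. Qed.

Lemma del_id j ds : j \notin ds -> del j ds = ds.
Proof.
move=> jds; apply/all_filterP/allP => k kds.
by apply: contraNneq jds => <-.
Qed.

Lemma del_head j ds : j \notin ds -> del j (j :: ds) = ds.
Proof. by move=> jds; rewrite /del /= eqxx; exact: del_id. Qed.

(** Off-diagonal terms of a symmetric sum pair up, hence cancel modulo 2. *)
Lemma sum_sym_pchar2 (a : nat -> nat -> K) ds :
  2%N \in [pchar K] -> (forall j k, a j k = a k j) ->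
  \sum_(j <- ds) \sum_(k <- ds | k != j) a j k = 0.
Proof.
move=> K2 asym; elim: ds => [|x ds IH]; first by rewrite big_nil.
rewrite big_cons big_cons eqxx /=.
under [X in _ + X]eq_bigr do rewrite big_cons.
rewrite [X in _ + X](eq_bigr (fun j => (if j != x then a x j else 0) +
    \sum_(k <- ds | k != j) a j k)); last first.
  move=> j _; rewrite [x == j]eq_sym; case: eqP => _ /=; rewrite ?add0r //.
  by rewrite (asym j x).
by rewrite big_split /= IH addr0 -big_mkcond /= addrr_pchar2.
Qed.

Variable s : nat -> (nat -> nat) -> K.

(** The cup product of the coboundaries of the labels [s i], [i] in [fs], on the
    cube at [p] spanned by the directions [ds]: the sum over the monotone paths
    from [p] with distinct directions in [ds] of the product of the increments of
    the labels, one label for each edge, in the order of [fs]. *)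
Fixpoint cup fs ds p : K :=
  if fs is i :: fs' then
    \sum_(j <- ds) (s i (step j p) - s i p) * cup fs' (del j ds) (step j p)
  else 1.

(** The cocycle identity. By the discrete Leibniz rule each summand splits into
    mixed second differences of the first label, symmetric in the two directions
    and therefore cancelling modulo 2, and differences of the remaining product,
    which vanish by induction. *)
Lemma cup_closed fs ds p : 2%N \in [pchar K] ->
  \sum_(j <- ds) (cup fs (del j ds) (step j p) - cup fs (del j ds) p) = 0.
Proof.
move=> K2; elim: fs ds p => [|i fs IH] ds p /=.
  by rewrite big1 // => j _; rewrite subrr.
pose C j k q := cup fs (del k (del j ds)) q.
have CC j k q : C j k q = C k j q by rewrite /C delC.
pose a j k := (s i (step k (step j p)) - s i (step j p) - s i (step k p) + s i p)
  * C j k (step k (step j p)).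
pose b j k := (s i (step k p) - s i p) *
  (C j k (step j (step k p)) - C j k (step k p)).
rewrite (eq_bigr (fun j => \sum_(k <- ds | k != j) a j k +
                           \sum_(k <- ds | k != j) b j k)); last first.
  move=> j _; rewrite !big_filter -sumrB -big_split; apply: eq_bigr => k _ /=.
  by rewrite /a /b -/(C j k _) -/(C j k _) (stepC j k); ring.
rewrite big_split /= (sum_sym_pchar2 _ K2) ?add0r; last first.
  by move=> j k; rewrite /a CC (stepC k j); congr (_ * _); ring.
rewrite (exchange_big_dep xpredT) //= big1 // => k _.
rewrite (eq_bigl (fun j => j != k)); last by move=> j; rewrite eq_sym.
rewrite -big_distrr /= -big_filter -/(del k ds).
rewrite (eq_bigr (fun j => cup fs (del j (del k ds)) (step j (step k p))
   - cup fs (del j (del k ds)) (step k p))) ?IH ?mulr0 //.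
by move=> j _; rewrite !(CC j).
Qed.

(** A nonzero cup product has a path with no zero factor, so every label changes
    along some edge of the cube. *)
Lemma cup_neq0 fs ds p i : cup fs ds p != 0 -> i \in fs ->
  exists r r', [/\ forall k, (p k <= r k <= p k + (k \in ds))%N,
    forall k, (p k <= r' k <= p k + (k \in ds))%N & s i r != s i r'].
Proof.
elim: fs ds p => [|i' fs IH] ds p //= cup0 ifs.
have [j jds] : exists2 j, j \in ds &
    (s i' (step j p) - s i' p) * cup fs (del j ds) (step j p) != 0.
  apply/not_exists2P => all0; move/negP: cup0; apply.
  rewrite big_seq big1 // => j jds; have [//|/negP/negPn/eqP ->//] := all0 j.
have step_le k : (p k <= step j p k <= p k + (k \in ds))%N.
  by rewrite /step leq_addr leq_add2l; case: eqP => // ->; rewrite jds.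
move=> neq0; move: ifs; rewrite inE => /orP[/eqP ->|ifs].
  exists (step j p), p; split => [||].
  - exact: step_le.
  - by move=> k; rewrite leqnn leq_addr.
  - by rewrite -subr_eq0; apply: contra neq0 => /eqP ->; rewrite mul0r.
have [|r [r' [rP r'P rr']]] := IH (del j ds) (step j p) _ ifs.
  by apply: contra neq0 => /eqP ->; rewrite mulr0.
have box q : (forall k, (step j p k <= q k <= step j p k + (k \in del j ds))%N) ->
    forall k, (p k <= q k <= p k + (k \in ds))%N.
  move=> qP k; have := qP k; rewrite mem_del /step.
  by case: (eqVneq k j) => [->|_]; rewrite ?jds /=; lia.
by exists r, r'; split => //; exact: box.
Qed.

Variable N : nat.

(** On a face transverse to [j] on which the label [s j] is constant, the
    coboundary of that label is zero and kills the product. *)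
Lemma cup_face fs ds p j c : j \in fs -> j \notin ds ->
  (forall k, (p k + (k \in ds) <= N)%N) ->
  (forall r, r j = p j -> (forall k, (r k <= N)%N) -> s j r = c) ->
  cup fs ds p = 0.
Proof.
elim: fs ds p => [|i fs IH] ds p //= jfs jds pN sc.
rewrite big_seq big1 // => m mds.
have mj : j != m by apply: contraNneq jds => ->.
have stepj : step m p j = p j by rewrite /step (negPf mj) addn0.
have stepN k : (step m p k + (k \in del m ds) <= N)%N.
  have := pN k; rewrite mem_del /step.
  by case: (eqVneq k m) => [->|_]; rewrite ?mds /=; lia.
have [ij|ij] := eqVneq j i.
  rewrite -ij !sc ?subrr ?mul0r // => k.
    by have := pN k; lia.
  by have := stepN k; lia.
rewrite IH ?mulr0 //.
- by move: jfs; rewrite inE (negPf ij).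
- by rewrite mem_del (negPf jds) andbF.
- by rewrite stepj.
Qed.

Fixpoint boxsum ds (f : (nat -> nat) -> K) p : K :=
  if ds is j :: ds' then \sum_(x < N) boxsum ds' f (upd p j x) else f p.

Lemma eq_boxsum ds f g p :
  (forall q, (forall k, k \notin ds -> q k = p k) ->
     (forall k, k \in ds -> (q k < N)%N) -> f q = g q) ->
  boxsum ds f p = boxsum ds g p.
Proof.
elim: ds p => [|j ds IH] p fg /=; first by apply: fg.
apply: eq_bigr => x _; apply: IH => q qout qin; apply: fg => k.
  by rewrite inE negb_or => /andP[kj kds]; rewrite qout // /upd (negPf kj).
rewrite inE; case: (boolP (k \in ds)) => [kds _|kds]; first exact: qin.
rewrite orbF => /eqP kj.
by rewrite qout // kj /upd eqxx.
Qed.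

Lemma boxsum_sum ds (J : seq nat) (F : nat -> (nat -> nat) -> K) p :
  boxsum ds (fun q => \sum_(j <- J) F j q) p = \sum_(j <- J) boxsum ds (F j) p.
Proof.
elim: ds p => [|k ds IH] p //=.
by rewrite exchange_big; apply: eq_bigr => x _; rewrite IH.
Qed.

Lemma boxsumB ds f g p :
  boxsum ds (fun q => f q - g q) p = boxsum ds f p - boxsum ds g p.
Proof.
elim: ds p => [|k ds IH] p //=.
by rewrite -sumrB; apply: eq_bigr => x _; rewrite IH.
Qed.

Lemma boxsum0 ds p : boxsum ds (fun=> 0) p = 0.
Proof. by elim: ds p => //= k ds IH p; rewrite big1. Qed.

Lemma boxsum_del j ds f p : uniq ds -> j \in ds ->
  boxsum ds f p = \sum_(x < N) boxsum (del j ds) f (upd p j x).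
Proof.
elim: ds p => [|k ds IH] p //= /andP[kds uds].
have [<- _|jk] := eqVneq k j; first by rewrite -/(del k ds) del_id.
rewrite inE eq_sym (negPf jk) /= => jds.
under eq_bigr do rewrite IH //.
rewrite exchange_big /=; apply: eq_bigr => x _; apply: eq_bigr => y _.
by rewrite updC // eq_sym.
Qed.

Lemma boxsum_step j ds f p : j \notin ds ->
  boxsum ds (fun q => f (step j q)) p = boxsum ds f (step j p).
Proof.
elim: ds p => [|k ds IH] p //=; rewrite inE negb_or => /andP[jk jds].
by apply: eq_bigr => x _; rewrite IH // step_updC // eq_sym.
Qed.

Lemma boxsum_diff j ds f p : uniq ds -> j \in ds ->
  boxsum ds (fun q => f (step j q) - f q) p =
  boxsum (del j ds) f (upd p j N) - boxsum (del j ds) f (upd p j 0%N).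
Proof.
move=> uds jds; rewrite (boxsum_del _ _ uds jds).
rewrite -(telescope_sumr (fun x => boxsum (del j ds) f (upd p j x)) (leq0n N)).
rewrite big_mkord; apply: eq_bigr => x _.
rewrite boxsumB boxsum_step ?step_upd //.
by rewrite mem_del eqxx.
Qed.

Hypothesis s0 : forall i p, (forall k, (p k <= N)%N) -> p i = 0%N -> s i p = 0.
Hypothesis sN : forall i p, (forall k, (p k <= N)%N) -> p i = N -> s i p = 1.

(** Stokes' formula: by [cup_closed], [cup (i :: ds) _] is the coboundary of the
    product of [s i] and [cup ds _], so its sum over the box is a sum over the
    boundary faces. The faces transverse to [j != i] contribute nothing by
    [cup_face]. Of the two faces transverse to [i], the label [s i] is 0 on one
    and 1 on the other, which leaves the sum in one dimension less. *)
Lemma boxsum_cup ds p : 2%N \in [pchar K] -> uniq ds -> (forall k, (p k <= N)%N) ->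
  boxsum ds (cup ds ds) p = 1.
Proof.
move=> K2; elim: ds p => [|i ds IH] p //; set ds1 := i :: ds => uds1 pN.
have /andP[ids uds] : (i \notin ds) && uniq ds by [].
pose G j q := cup ds (del j ds1) q.
(* The discrete Leibniz rule; the remaining term is zero by [cup_closed]. *)
have -> : boxsum ds1 (cup ds1 ds1) p = boxsum ds1 (fun q =>
    \sum_(j <- ds1) (s i (step j q) * G j (step j q) - s i q * G j q)) p.
  apply: eq_boxsum => q _ _; apply/eqP; rewrite -subr_eq0 -sumrB.
  rewrite (eq_bigr (fun j => - s i q *
      (cup ds (del j ds1) (step j q) - cup ds (del j ds1) q))); last first.
    by move=> j _; rewrite /G -/(cup ds (del j ds1) (step j q)); ring.
  by rewrite -big_distrr /= cup_closed // mulr0.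
pose f j q := s i q * G j q.
rewrite boxsum_sum (eq_big_seq (fun j => boxsum (del j ds1) (f j) (upd p j N)
    - boxsum (del j ds1) (f j) (upd p j 0%N))); last first.
  by move=> j jds; rewrite (boxsum_diff (f j)).
have le_upd j x q : (x <= N)%N ->
    (forall k, k \notin del j ds1 -> q k = upd p j x k) ->
    (forall k, k \in del j ds1 -> (q k < N)%N) ->
    q j = x /\ forall k, (q k + (k \in del j ds1) <= N)%N.
  move=> xN qout qin; split; first by rewrite qout ?mem_del ?eqxx // /upd eqxx.
  move=> k; have [kd|kd] := boolP (k \in _); first by have := qin _ kd; lia.
  by rewrite addn0 qout // /upd; case: ifP.
have leq q (b : nat -> bool) : (forall k, (q k + b k <= N)%N) ->
    forall k, (q k <= N)%N by move=> h k; have := h k; lia.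
rewrite /ds1 big_cons [X in _ + X]big_seq [X in _ + X]big1 ?addr0; last first.
  move=> j jds; have ji : i != j by apply: contraNneq ids => ->.
  have vanish x c : (x <= N)%N -> (forall r, (forall k, (r k <= N)%N) ->
      r j = x -> s j r = c) -> boxsum (del j ds1) (f j) (upd p j x) = 0.
    move=> xN sc; rewrite -(boxsum0 (del j ds1) (upd p j x)).
    apply: eq_boxsum => q qout qin; have [qj qN] := le_upd _ _ _ xN qout qin.
    rewrite /f /G (@cup_face _ _ _ j c) ?mulr0 ?mem_del ?eqxx //.
    by move=> r rq rN; apply: sc; rewrite // rq.
  rewrite (@vanish N 1) // => [|r rN rj]; last exact: sN.
  by rewrite (@vanish 0%N 0) ?subr0 // => r rN rj; exact: s0.
have E x : boxsum (del i ds1) (f i) (upd p i x) =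
    boxsum ds (fun q => s i q * cup ds ds q) (upd p i x).
  by rewrite /f /G /ds1 (del_head ids).
rewrite !E.
have -> : boxsum ds (fun q => s i q * cup ds ds q) (upd p i N) =
          boxsum ds (cup ds ds) (upd p i N).
  apply: eq_boxsum => q qout qin.
  have [] := le_upd i N q (leqnn _); rewrite ?(del_head ids) //.
  by move=> qi /leq qN; rewrite sN ?mul1r.
have -> : boxsum ds (fun q => s i q * cup ds ds q) (upd p i 0%N) = 0.
  rewrite -(boxsum0 ds (upd p i 0%N)); apply: eq_boxsum => q qout qin.
  have [] := le_upd i 0%N q (leq0n _); rewrite ?(del_head ids) //.
  by move=> qi /leq qN; rewrite s0 ?mul0r.
by rewrite subr0 IH // => k; rewrite /upd; case: ifP.
Qed.

Lemma boxsum_neq0 ds f p : boxsum ds f p != 0 ->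
  exists q, [/\ forall k, k \notin ds -> q k = p k,
    forall k, k \in ds -> (q k < N)%N & f q != 0].
Proof.
move=> fneq0; apply: contrapT => noq; move/negP: fneq0; apply; apply/eqP.
rewrite -(boxsum0 ds p); apply: eq_boxsum => q qout qin.
by apply/eqP/negPn/negP => fq; apply: noq; exists q.
Qed.

End CubicalStokes.

(** The sum of the cup products over the grid is 1 by [boxsum_cup], so one of them
    is nonzero, and [cup_neq0] applies to it. *)
Lemma common_sign_change_cube (n N : nat) (s : nat -> (nat -> nat) -> bool) :
  (forall i p, (forall k, (p k <= N)%N) -> p i = 0%N -> s i p = false) ->
  (forall i p, (forall k, (p k <= N)%N) -> p i = N -> s i p = true) ->
  exists p, (forall k, (p k <= N)%N) /\ forall i, (i < n)%N ->
    exists r r', [/\ forall k, (p k <= r k <= minn N (p k).+1)%N,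
      forall k, (p k <= r' k <= minn N (p k).+1)%N, s i r = false & s i r' = true].
Proof.
move=> s0 sN; pose K : comNzRingType := 'F_2.
pose sK i p : K := (s i p)%:R.
have K2 : 2%N \in [pchar K] by exact: pchar_Fp.
have : boxsum N (iota 0 n) (cup sK (iota 0 n) (iota 0 n)) (fun=> 0%N) != 0.
  rewrite boxsum_cup ?oner_eq0 ?iota_uniq // => i p pN pi; rewrite /sK.
    by rewrite s0.
  by rewrite sN.
move=> /boxsum_neq0[p [pout pin cup0]]; exists p.
have pN k : (p k + (k \in iota 0 n) <= N)%N.
  have := pin k; have := pout k; case: (k \in iota 0 n) => /= pk1 pk2.
    by have := pk2 isT; lia.
  by rewrite pk1.
split=> [k|i ilt]; first by have := pN k; lia.
have [|r [r' [rP r'P]]] := cup_neq0 cup0 (i := i); first by rewrite mem_iota.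
have box q : (forall k, (p k <= q k <= p k + (k \in iota 0 n))%N) ->
    forall k, (p k <= q k <= minn N (p k).+1)%N.
  by move=> qP k; have := qP k; have := pN k; case: (_ \in _); lia.
rewrite /sK; have {}rP := box _ rP; have {}r'P := box _ r'P.
case sr : (s i r); case sr' : (s i r'); rewrite ?eqxx // => _.
  by exists r', r.
by exists r, r'.
Qed.

(** * The Poincare-Miranda theorem *)

Section RowNorm.
Variables (R : realType) (n : nat).
Implicit Types v : 'rV[R]_n.

Lemma coord_le_norm v i : `|v ord0 i| <= `|v|.
Proof.
by rewrite [leRHS]/Num.norm /= mx_normrE; apply/bigmax_geP; right; exists (ord0, i).
Qed.

Lemma norm_le_coord v c : 0 <= c -> (forall i, `|v ord0 i| <= c) -> `|v| <= c.
Proof.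
move=> c0 vc; rewrite [leLHS]/Num.norm /= mx_normrE; apply/bigmax_leP; split=> //.
by move=> -[i j] _ /=; rewrite ord1.
Qed.

Lemma compact_unit_cube : compact [set v : 'rV[R]_n | `|v| <= 1].
Proof.
apply: bounded_closed_compact.
  by exists 1; split=> // M M1 v /= v1; exact: le_trans v1 (ltW M1).
have /continuous_closedP := @norm_continuous R 'rV[R]_n.
by move=> /(_ _ (@closed_le R 1)).
Qed.

End RowNorm.

Section PoincareMiranda.
Variables (R : realType) (n : nat) (F : 'rV[R]_n.+1 -> 'rV[R]_n.+1).
Hypothesis F_le0 : forall (v : 'rV_n.+1) i,
  `|v| <= 1 -> v ord0 i = -1 -> F v ord0 i <= 0.
Hypothesis F_ge0 : forall (v : 'rV_n.+1) i,
  `|v| <= 1 -> v ord0 i = 1 -> 0 <= F v ord0 i.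

(** The grid of mesh [2 / N.+1] on the cube is labelled by the signs of the
    coordinates of [F]. *)
Lemma cell_sign_change (N : nat) : exists x : 'rV[R]_n.+1, `|x| <= 1 /\
  forall i, exists y y', [/\ `|x - y| <= 2 / N.+1%:R, `|x - y'| <= 2 / N.+1%:R,
    F y ord0 i <= 0 & 0 <= F y' ord0 i].
Proof.
set M := N.+1; have M0 : (0 : R) < M%:R by rewrite ltr0n.
pose grid (p : nat -> nat) : 'rV[R]_n.+1 := \row_i (2 * (p i)%:R / M%:R - 1).
have grid1 p : (forall k, (p k <= M)%N) -> `|grid p| <= 1.
  move=> pM; apply: norm_le_coord => // i; rewrite mxE ler_norml.
  have : (p i)%:R / M%:R <= 1 :> R by rewrite ler_pdivrMr // mul1r ler_nat.
  have : 0 <= (p i)%:R / M%:R :> R by rewrite divr_ge0.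
  by rewrite -mulrA; lra.
(* The boundary faces are labelled by fiat, since [F] may vanish there. *)
pose s (i : nat) p :=
  (p i == M) || (p i != 0%N) && (0 < F (grid p) ord0 (inord i)).
have [|i p pM pi|p [pM pP]] := @common_sign_change_cube n.+1 M s.
- by move=> i p pM pi; rewrite /s pi.
- by rewrite /s pi eqxx.
have close r : (forall k, (p k <= r k <= minn M (p k).+1)%N) ->
    `|grid p - grid r| <= 2 / M%:R.
  move=> rP; apply: norm_le_coord => [|i]; first by rewrite divr_ge0.
  rewrite !mxE.
  have -> : 2 * (p i)%:R / M%:R - 1 - (2 * (r i)%:R / M%:R - 1) =
      - ((2 / M%:R) * (r i - p i)%:R) :> R.
    by rewrite natrB; [field; rewrite gt_eqF|have := rP i; lia].
  rewrite normrN ger0_norm ?mulr_ge0 ?divr_ge0 // ler_piMr ?divr_ge0 //.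
  by rewrite (ler_nat _ _ 1); have := rP i; lia.
have rM r : (forall k, (p k <= r k <= minn M (p k).+1)%N) ->
    forall k, (r k <= M)%N by move=> rP k; have := rP k; lia.
exists (grid p); split; first exact: grid1.
move=> i; have [r [r' [rP r'P sr sr']]] := pP i (ltn_ord i).
exists (grid r), (grid r'); split; [exact: close|exact: close| |].
  move: sr; rewrite /s; case: eqP => //= riM.
  have [ri0 _|_ /=] := eqVneq (r i) 0%N.
    by apply: F_le0; rewrite ?grid1 ?mxE ?ri0 ?mulr0 ?mul0r ?sub0r //; exact: rM.
  by rewrite inord_val => /negbT; rewrite -leNgt.
move: sr'; rewrite /s => /orP[/eqP riM|/andP[_]].
  apply: F_ge0; first by apply: grid1; exact: rM.
  by rewrite mxE riM mulfK ?gt_eqF //; lra.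
by rewrite inord_val; exact: ltW.
Qed.

(** Near a cluster point of the cells of [cell_sign_change], every coordinate of
    [F] takes nonpositive and nonnegative values, so it vanishes there. *)
Theorem poincare_miranda : continuous F -> exists v, F v = 0.
Proof.
move=> cF; have /choice[x xP] := cell_sign_change.
have xcube : (x @ \oo) [set v : 'rV[R]_n.+1 | `|v| <= 1].
  by exists 0%N => // N _; have [] := xP N.
have [v [_ vx]] := @compact_unit_cube R n.+1 (x @ \oo) _ xcube.
exists v; apply/rowP => i; rewrite [RHS]mxE; apply/eqP/negPn/negP => Fv0.
have cFi : (fun w => F w ord0 i) @ v --> F v ord0 i.
  apply: (@continuous_comp _ _ _ F (fun w : 'rV[R]_n.+1 => w ord0 i)).
    exact: cF.
  exact: coord_continuous.
have e0 : 0 < `|F v ord0 i| by rewrite normr_gt0.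
have /cvgrPdist_lt/(_ _ e0)/nbhs_ballP[d /= d0 dP] := cFi.
have d2 : 0 < d / 2 by rewrite divr_gt0.
have d4 : 0 < d / 4 by rewrite divr_gt0.
have [N _ NP] := near_infty_natSinv_lt (PosNum d4).
have {}NP M : (N <= M)%N -> 2 / M.+1%:R < d / 2 
  by move=> /NP /= MN; rewrite (_ : d / 2 = 2 * (d / 4)) ?ltr_pM2l //; lra.
have /vx/(_ (nbhsx_ballx v _ d2))[_ [[M /= NM <-]]] :
    (x @ \oo) [set x M | M in [set M | (N <= M)%N]].
  by exists N => // M /= NM; exists M.
rewrite -ball_normE /= => vxM.
have [_ /(_ i)[y [y' [xy xy' Fy Fy']]]] := xP M.
have near z : `|x M - z| <= 2 / M.+1%:R ->
    `|F v ord0 i - F z ord0 i| < `|F v ord0 i|.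
  move=> xz; apply: dP; rewrite -ball_normE /=.
  rewrite (le_lt_trans (ler_distD (x M) _ _)) // [d]splitr ltrD //.
  exact: le_lt_trans (NP M NM).
have := near y' xy'; have := near y xy; move: Fy Fy' Fv0.
move: (F v ord0 i) (F y ord0 i) (F y' ord0 i) => a b b' b0 b'0.
rewrite neq_lt => /orP[a0|a0]; rewrite ?(ltr0_norm a0) ?(gtr0_norm a0) !ltr_norml.
  by move=> _ /andP[]; lra.
by move=> /andP[]; lra.
Qed.

End PoincareMiranda.

(** * Lusternik-Schnirelmann category of a topological sphere *)

Section TopologicalSphere.
Variables (R : realType) (n : nat) (X : topologicalType) (nu : X -> 'rV[R]_n.+1).
Hypothesis compX : compact [set: X].
Hypothesis nu_cont : continuous nu.
Hypothesis nu_norm : forall x, `|nu x| = 1.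
Hypothesis nu_inj : injective nu.
Hypothesis nu_surj : forall v : 'rV[R]_n.+1, `|v| = 1 -> exists x, nu x = v.

Let one_vec : 'rV[R]_n.+1 := const_mx 1.

Lemma norm_one_vec : `|one_vec| = 1.
Proof.
apply/eqP; rewrite eq_le norm_le_coord //=.
  by have := coord_le_norm one_vec ord0; rewrite mxE normr1.
by move=> i; rewrite mxE normr1.
Qed.

Lemma normalize_norm (v : 'rV[R]_n.+1) : v != 0 -> `| `|v|^-1 *: v | = 1.
Proof.
by move=> v0; rewrite normrZ normfV normr_id mulVf // normr_eq0.
Qed.

(** A continuous bijection from a compact space to the sphere is a homeomorphism;
    composing its inverse with the radial projection gives a section defined off
    the origin. *)
Lemma radial_section : exists P : 'rV[R]_n.+1 -> X,
  (forall v : 'rV_n.+1, v != 0 -> nu (P v) = `|v|^-1 *: v) /\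
  (forall v : 'rV_n.+1, v != 0 -> {for v, continuous P}).
Proof.
have [x0 _] := nu_surj norm_one_vec.
have /choice[P PE] : forall v : 'rV[R]_n.+1,
    exists x, v != 0 -> nu x = `|v|^-1 *: v.
  move=> v; have [->|v0] := eqVneq v 0; first by exists x0.
  by have [x xv] := nu_surj (normalize_norm v0); exists x.
exists P; split=> // v v0; rewrite /continuous_at => U.
rewrite nbhsE => -[V [oV VP] VU].
suff : \forall w \near v, V (P w) by apply: filterS => w; exact: VU.
have VC : closed (nu @` (~` V)).
  apply: compact_closed; first exact: norm_hausdorff.
  apply: continuous_compact; first exact: continuous_subspaceT.
  by apply: (subclosed_compact _ compX) => //; exact: open_closedC.
have normalize_cont :
    {for v, continuous (fun w : 'rV[R]_n.+1 => `|w|^-1 *: w)}.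
  apply: (@continuousZ _ _ _ (fun w : 'rV[R]_n.+1 => `|w|^-1) id v).
    apply: (@continuousV _ _ (fun w : 'rV[R]_n.+1 => `|w|) v).
      by rewrite normr_eq0.
    exact: norm_continuous.
  exact: cvg_id.
have v_V : \forall w \near v, (~` (nu @` (~` V))) (`|w|^-1 *: w).
  apply: normalize_cont; apply: open_nbhs_nbhs; split; first exact: closed_openC.
  by rewrite -PE // => -[x VCx /nu_inj xP]; apply: VCx; rewrite xP.
have v_neq0 : \forall w \near v, w != 0.
  have /continuousP/(_ _ (@open_neq R 0)) oD := @norm_continuous R 'rV[R]_n.+1.
  have : nbhs v ((fun w : 'rV[R]_n.+1 => `|w|) @^-1` [set r | r != 0]).
    by apply: open_nbhs_nbhs; split=> //=; rewrite normr_eq0.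
  by apply: filterS => w /=; rewrite normr_eq0.
apply: filterS2 v_neq0 v_V => w w0 wV; apply: contrapT => PwV; apply: wV.
by exists (P w) => //; exact: PE.
Qed.

Section RadialSection.
Variable P : 'rV[R]_n.+1 -> X.
Hypothesis PE : forall v : 'rV_n.+1, v != 0 -> nu (P v) = `|v|^-1 *: v.
Hypothesis P_cont : forall v : 'rV_n.+1, v != 0 -> {for v, continuous P}.

Lemma section_nu (a : R) x : 0 < a -> P (a *: nu x) = x.
Proof.
move=> a0; apply: nu_inj; have nux0 : nu x != 0.
  by rewrite -normr_eq0 nu_norm oner_eq0.
rewrite PE ?scaler_eq0 ?negb_or ?gt_eqF //=.
by rewrite normrZ nu_norm mulr1 gtr0_norm // scalerA mulVf ?scale1r ?gt_eqF.
Qed.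

(** The straight line homotopy to the antipode of [x0] meets the origin only when
    it starts at [x0]; it is then pushed back to [X] by the radial section. *)
Lemma contractible_punctured (x0 : X) : contractible_in R (~` [set x0]).
Proof.
pose L (p : R * X) := (1 - p.1) *: nu p.2 - p.1 *: nu x0.
exists (P \o L), (P (- nu x0)); split.
- apply: continuous_in_subspaceT => -[t x]; rewrite inE /= => -[t01 xx0].
  apply: (@continuous_comp _ _ _ L P); last first.
    apply: P_cont; rewrite subr_eq0; apply: contra_notN xx0 => /eqP /= tx.
    move: t01; rewrite in_itv /= => /andP[t0 t1].
    have := congr1 Num.norm tx; rewrite !normrZ !nu_norm !mulr1.
    rewrite !ger0_norm ?subr_ge0 // => tE.
    apply: nu_inj; move: tx; rewrite tE => /scalerI; apply.
    by rewrite gt_eqF //; lra.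
  have c1 : {for (t, x), continuous (fst : R * X -> R)} by exact: cvg_fst.
  have c2 : {for (t, x), continuous (snd : R * X -> X)} by exact: cvg_snd.
  apply: (@continuousB _ _ _ (fun p : R * X => (1 - p.1) *: nu p.2)
    (fun p : R * X => p.1 *: nu x0)).
    apply: (@continuousZ _ _ _ (fun p : R * X => 1 - p.1)
      (fun p : R * X => nu p.2)).
      by apply: (@continuousB _ R^o _ (cst 1) fst) => //; exact: cst_continuous.
    apply: (@continuous_comp _ _ _ snd nu) => //.
    exact: (@nu_cont x).
  by apply: (@continuousZ _ _ _ fst (cst (nu x0))) => //; exact: cst_continuous.
- move=> x _; rewrite /= /L /= subr0 scale0r subr0.
  by rewrite section_nu.
- by move=> x _; rewrite /= /L /= subrr scale0r sub0r scale1r.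
Qed.

(** A contraction of [X] extends the identity of the unit sphere to a nowhere zero
    map of the cube: run the contraction as the radius decreases from 1 to 1/2,
    and stay constant below 1/2, which makes continuity at the origin immediate.
    The theorem of Poincare and Miranda forbids such a map. *)
Lemma not_contractible_setT : ~ contractible_in R [set: X].
Proof.
move=> [H [c [cH H0 H1]]].
pose clamp (v : 'rV[R]_n.+1) : R := Num.max 0 (Num.min 1 (2 - 2 * `|v|)).
pose F v := nu (H (clamp v, P v)).
have clamp01 v : clamp v \in `[0, 1].
  by rewrite in_itv /= le_max lexx /= ge_max ler01 ge_min lexx.
have clamp_cont : continuous clamp.
  move=> v; apply: (@continuous_max _ _ (cst 0)
    (fun v => Num.min 1 (2 - 2 * `|v|)) v).
    exact: (@cst_continuous _ _ _ v).
  apply: (@continuous_min _ _ (cst 1) (fun v => 2 - 2 * `|v|) v).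
    exact: (@cst_continuous _ _ _ v).
  apply: (@continuousB _ R^o _ (cst 2) (fun v => 2 * `|v|) v).
    exact: (@cst_continuous _ _ _ v).
  apply: (@continuousM _ _ (cst 2) (fun v => `|v|) v).
    exact: (@cst_continuous _ _ _ v).
  exact: (@norm_continuous _ _ v).
have clamp_in (v : 'rV[R]_n.+1) : `|v| <= 1 / 2 -> clamp v = 1.
  by move=> v2; rewrite /clamp min_l ?max_r //; lra.
have clamp_out (v : 'rV[R]_n.+1) : `|v| = 1 -> clamp v = 0.
  by move=> v2; rewrite /clamp v2 min_r ?max_l //; lra.
have F_boundary (v : 'rV[R]_n.+1) : `|v| = 1 -> F v = v.
  move=> v1; have v0 : v != 0 by rewrite -normr_eq0 v1 oner_eq0.
  by rewrite /F clamp_out // H0 // PE // v1 invr1 scale1r.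
have norm1 (v : 'rV[R]_n.+1) i : `|v| <= 1 -> `|v ord0 i| = 1 -> `|v| = 1.
  move=> v1 vi; apply/eqP; rewrite eq_le v1 /= -vi; exact: coord_le_norm.
have [v i v1 vi|v i v1 vi||v Fv0] := @poincare_miranda R n F.
- have vn : `|v| = 1 by apply: (norm1 v i v1); rewrite vi normrN1.
  by rewrite (F_boundary v vn) vi lerN10.
- have vn : `|v| = 1 by apply: (norm1 v i v1); rewrite vi normr1.
  by rewrite (F_boundary v vn) vi ler01.
- move=> v; have [->|v0] := eqVneq v 0.
    have F0 w : `|w| <= 1 / 2 -> F w = nu c by move=> w2; rewrite /F clamp_in // H1.
    rewrite /continuous_at (F0 0) ?normr0 ?divr_ge0 //.
    have half : nbhs (0 : 'rV[R]_n.+1) (ball 0 (1 / 2)).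
      by apply: nbhsx_ballx; rewrite divr_gt0.
    apply: (@cvg_near_cst _ _ (nu c) F (nbhs (0 : 'rV[R]_n.+1))).
    apply: filterS half => w.
    by rewrite -ball_normE /= sub0r normrN => /ltW; exact: F0.
  apply: (@continuous_comp _ _ _ (fun v => H (clamp v, P v)) nu);
    last exact: (@nu_cont _).
  move: cH => /subspace_continuousP/(_ (clamp v, P v)) cH.
  apply: cvg_comp (cH _); last by split=> //; exact: clamp01.
  move=> B /= BH.
  have : (fun w => (clamp w, P w)) @ v --> (clamp v, P v).
    apply: (@cvg_pair _ _ _ (nbhs v) (nbhs (clamp v)) (nbhs (P v)) _ _ _ clamp P).
      exact: (@clamp_cont v).
    exact: P_cont.
  by move=> /(_ _ BH); apply: (@filterS _ (nbhs v)) => w; apply; split=> //;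
    exact: clamp01.
- have := nu_norm (H (clamp v, P v)); rewrite -/(F v) Fv0 normr0 => /eqP.
  by rewrite eq_sym oner_eq0.
Qed.

End RadialSection.

(** Two punctured spheres cover, and one contractible set does not. *)
Theorem LScat_topological_sphere : LScat R X = Some 2%N.
Proof.
have [P [PE P_cont]] := radial_section.
have cover2 : categorical_cover R X 2.
  have [x0 x0E] := nu_surj norm_one_vec.
  have [|x1 x1E] := nu_surj (v := - one_vec); first by rewrite normrN norm_one_vec.
  have x01 : x0 != x1.
    apply/eqP => /(congr1 nu); rewrite x0E x1E => /eqP.
    rewrite -addr_eq0 -mulr2n -scaler_nat scaler_eq0 pnatr_eq0 /=.
    by rewrite -normr_eq0 norm_one_vec oner_eq0.
  have closed1 (x : X) : closed [set x].
    have -> : [set x] = nu @^-1` [set nu x].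
      by apply/seteqP; split=> y /= => [->|/nu_inj].
    have /continuous_closedP := nu_cont; apply.
    by apply/accessible_closed_set1/hausdorff_accessible/norm_hausdorff.
  exists (fun i => ~` [set if i == ord0 then x0 else x1]); split.
    move=> i; split; first exact: closed_openC.
    exact: (contractible_punctured PE P_cont).
  apply/seteqP; split=> // x _; have [xx0|xx0] := eqVneq x x0.
    by exists ord_max => //=; rewrite xx0; exact/eqP.
  by exists ord0 => //=; exact/eqP.
rewrite /LScat; case: pselect => [ex|[]]; last by exists 2%N; exact/asboolP.
congr Some; case: ex_minnP => k /asboolP[U [UP Ucover]] kmin.
apply/eqP; rewrite eqn_leq kmin /=; last exact/asboolP.
case: k U UP Ucover {kmin} => [|[|//]] U UP Ucover.
  have [x0 _] := nu_surj norm_one_vec.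
  by have : [set: X] x0 by []; rewrite -Ucover => -[[]].
case: (not_contractible_setT PE P_cont).
have <- : U ord0 = [set: X].
  rewrite -Ucover; apply/seteqP; split=> x; first by exists ord0.
  by move=> [i _]; rewrite ord1.
by have [] := UP ord0.
Qed.

End TopologicalSphere.

(** * Real quadratic forms in three variables *)

Section RealContinuity.
Variables (R : realType) (T : topologicalType) (x : T).
Implicit Types f g : T -> R.

Lemma continuous_atD f g : continuous_at x f -> continuous_at x g ->
  continuous_at x (fun t => f t + g t).
Proof. by move=> cf cg; exact: (@continuousD _ R^o _ f g). Qed.

Lemma continuous_atB f g : continuous_at x f -> continuous_at x g ->
  continuous_at x (fun t => f t - g t).
Proof. by move=> cf cg; exact: (@continuousB _ R^o _ f g). Qed.

Lemma continuous_atM f g : continuous_at x f -> continuous_at x g ->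
  continuous_at x (fun t => f t * g t).
Proof. by move=> cf cg; exact: (@continuousM _ _ f g). Qed.

Lemma continuous_at_sqr f : continuous_at x f -> continuous_at x (fun t => f t ^+ 2).
Proof. by move=> cf; exact: (@continuousM _ _ f f). Qed.

Lemma continuous_at_cst (k : R) : continuous_at x (fun=> k).
Proof. exact: cst_continuous. Qed.

End RealContinuity.

(** The operands are read off syntactically because higher-order unification does
    not find them. *)
Ltac polynomial_continuous := repeat match goal with
  | |- continuous_at ?x (fun t => @?f t - @?g t) => apply: (@continuous_atB _ _ x f g)
  | |- continuous_at ?x (fun t => @?f t + @?g t) => apply: (@continuous_atD _ _ x f g)
  | |- continuous_at ?x (fun t => @?f t * @?g t) => apply: (@continuous_atM _ _ x f g)
  | |- continuous_at ?x (fun t => @?f t ^+ 2) => apply: (@continuous_at_sqr _ _ x f)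
  | |- continuous_at ?x (fun=> ?k) => exact: (@continuous_at_cst _ _ x k)
  end.

Definition o0 := @Ordinal 3 0 isT.
Definition o1 := @Ordinal 3 1 isT.
Definition o2 := @Ordinal 3 2 isT.

Section PsdForms.
Variable R : realType.
Implicit Types a b c d e f : R.

(** The quadratic form of the symmetric matrix with diagonal [a, b, c] and entries
    [d], [e], [f] at the places (1,2), (1,3), (2,3); likewise for [det3]. *)
Definition form3 a b c d e f (u v w : R) : R :=
  a * u ^+ 2 + b * v ^+ 2 + c * w ^+ 2 + 2 * (d * u * v + e * u * w + f * v * w).

Definition det3 a b c d e f : R :=
  a * b * c + 2 * d * e * f - a * f ^+ 2 - b * e ^+ 2 - c * d ^+ 2.

(** First order condition at a minimum of a quadratic polynomial. *)
Lemma linear_ge0_eq0 b d : (forall s, 0 <= 2 * s * b + s ^+ 2 * d) -> b = 0.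
Proof.
move=> ge0; apply: contrapT => /eqP b0.
have d1 : 0 < `|d| + 1 by rewrite ltr_wpDl.
have := ge0 (- b / (`|d| + 1)).
have -> : 2 * (- b / (`|d| + 1)) * b + (- b / (`|d| + 1)) ^+ 2 * d =
  (b / (`|d| + 1)) ^+ 2 * (d - 2 * (`|d| + 1)).
  by field; rewrite gt_eqF.
apply/negP; rewrite -ltNge pmulr_rlt0; last first.
  by rewrite exprn_even_gt0 //= mulf_neq0 // invr_neq0 // gt_eqF.
by have := ler_norm d; have := normr_ge0 d; lra.
Qed.

Lemma psd2_rank1 b c f : 0 <= b -> 0 <= c -> b * c = f ^+ 2 ->
  exists y z, [/\ y ^+ 2 = b, z ^+ 2 = c & y * z = f].
Proof.
move=> b0 c0 bc; have [bE|bn0] := eqVneq b 0.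
  exists 0, (Num.sqrt c); rewrite sqr_sqrtr // expr0n bE mul0r; split=> //.
  by apply/esym/eqP; rewrite -sqrf_eq0 -bc bE mul0r.
have sb : Num.sqrt b != 0 by rewrite sqrtr_eq0 -ltNge lt_neqAle eq_sym bn0.
exists (Num.sqrt b), (f / Num.sqrt b); rewrite sqr_sqrtr //; split=> //.
  by rewrite exprMn exprVn sqr_sqrtr // -bc mulrAC mulfV ?mul1r.
by rewrite mulrC mulfVK.
Qed.

(** One step of Cholesky elimination leaves a singular positive semidefinite block
    of size 2, to which [psd2_rank1] applies. When the first pivot is zero, so is
    its row, and elimination starts at the second one. *)
Lemma psd_gram a b c d e f : (forall u v w, 0 <= form3 a b c d e f u v w) ->
  det3 a b c d e f = 0 ->
  exists x1 x2 x3 y1 y2 y3,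
    [/\ x1 ^+ 2 + y1 ^+ 2 = a, x2 ^+ 2 + y2 ^+ 2 = b & x3 ^+ 2 + y3 ^+ 2 = c] /\
    [/\ x1 * x2 + y1 * y2 = d, x1 * x3 + y1 * y3 = e & x2 * x3 + y2 * y3 = f].
Proof.
rewrite /form3 => psd det0.
have a0 : 0 <= a by have := psd 1 0 0; rewrite !(expr0n, expr1n) /=; lra.
have b0 : 0 <= b by have := psd 0 1 0; rewrite !(expr0n, expr1n) /=; lra.
have c0 : 0 <= c by have := psd 0 0 1; rewrite !(expr0n, expr1n) /=; lra.
have [aE|an0] := eqVneq a 0.
  have -> : d = 0.
    apply: (@linear_ge0_eq0 d b) => s; have := psd 1 s 0.
    by rewrite aE expr1n expr0n /=; lra.
  have -> : e = 0.
    apply: (@linear_ge0_eq0 e c) => s; have := psd 1 0 s.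
    by rewrite aE expr1n expr0n /=; lra.
  have [bE|bn0] := eqVneq b 0.
    have -> : f = 0.
      apply: (@linear_ge0_eq0 f c) => s; have := psd 0 1 s.
      by rewrite bE expr1n expr0n /=; lra.
    exists 0, 0, (Num.sqrt c), 0, 0, 0.
    by rewrite sqr_sqrtr // aE bE; do 2!split; ring.
  have bgt0 : 0 < b by rewrite lt_neqAle eq_sym bn0.
  have sb : Num.sqrt b != 0 by rewrite sqrtr_eq0 -ltNge.
  have cf : 0 <= c - f ^+ 2 / b.
    have := psd 0 (- f / b) 1.
    congr (_ <= _); rewrite aE; field; exact: bn0.
  exists 0, (Num.sqrt b), (f / Num.sqrt b), 0, 0, (Num.sqrt (c - f ^+ 2 / b)).
  rewrite !sqr_sqrtr // aE exprMn exprVn sqr_sqrtr // mulrC.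
  by do 2!split; rewrite ?(mulrC (Num.sqrt b)) ?mulfVK //; ring.
have agt0 : 0 < a by rewrite lt_neqAle eq_sym an0.
have sa : Num.sqrt a != 0 by rewrite sqrtr_eq0 -ltNge.
have [||| y2 [y3 [y2E y3E y23E]]] :=
    @psd2_rank1 (b - d ^+ 2 / a) (c - e ^+ 2 / a) (f - d * e / a).
- by have := psd (- d / a) 1 0; congr (_ <= _); field; exact: an0.
- by have := psd (- e / a) 0 1; congr (_ <= _); field; exact: an0.
- apply/eqP; rewrite -subr_eq0; apply/eqP.
  transitivity (det3 a b c d e f / a); last by rewrite det0 mul0r.
  by rewrite /det3; field; exact: an0.
have sa2 : (Num.sqrt a) ^+ 2 = a by rewrite sqr_sqrtr.
exists (Num.sqrt a), (d / Num.sqrt a), (e / Num.sqrt a), 0, y2, y3.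
rewrite !exprMn !exprVn y2E y3E y23E sa2; split; split; first by ring.
- by ring.
- by ring.
- by rewrite mul0r addr0 mulrC mulfVK.
- by rewrite mul0r addr0 mulrC mulfVK.
- rewrite -[in X in _ + (f - X)]sa2; field; exact: sa.
Qed.

(** Take for [m] the minimum of the form on the unit sphere. The shifted form is
    nonnegative and vanishes at a minimizer, which is thus a null vector of the
    shifted matrix, and its determinant is zero. *)
Lemma least_eigenvalue_shift a b c d e f : exists m,
  (forall u v w, 0 <= form3 (a - m) (b - m) (c - m) d e f u v w) /\
  det3 (a - m) (b - m) (c - m) d e f = 0.
Proof.
pose q (t : 'rV[R]_3) := form3 a b c d e f (t ord0 o0) (t ord0 o1) (t ord0 o2).
pose sq (t : 'rV[R]_3) := t ord0 o0 ^+ 2 + t ord0 o1 ^+ 2 + t ord0 o2 ^+ 2.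
pose vec (u v w : R) : 'rV[R]_3 := \row_j [:: u; v; w]`_j.
have qE u v w : q (vec u v w) = form3 a b c d e f u v w by rewrite /q !mxE.
have sqE u v w : sq (vec u v w) = u ^+ 2 + v ^+ 2 + w ^+ 2 by rewrite /sq !mxE.
have coord_cont (t : 'rV[R]_3) i : continuous_at t (fun s : 'rV[R]_3 => s ord0 i).
  exact: (@coord_continuous _ _ _ _ _ t).
have sq_cont : continuous sq.
  by move=> t; rewrite /sq; polynomial_continuous; exact: coord_cont.
have q_cont : continuous q.
  by move=> t; rewrite /q /form3; polynomial_continuous; exact: coord_cont.
pose S := [set t | sq t = 1].
have S_compact : compact S.
  apply: (subclosed_compact _ (@compact_unit_cube R 3)).
    have closed1 : closed [set 1 : R].
      by apply/accessible_closed_set1/hausdorff_accessible/Rhausdorff.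
    by move/continuous_closedP/(_ _ closed1): sq_cont.
  move=> t /= tS; apply: norm_le_coord => // i.
  rewrite -(expr_le1 (n := 2)) // real_normK ?num_real // -tS /sq.
  have ge0 j : 0 <= t ord0 j ^+ 2 by exact: sqr_ge0.
  have := ge0 o0; have := ge0 o1; have := ge0 o2.
  by case: i => -[|[|[|//]]] i3; rewrite (bool_irrelevance i3 isT); lra.
have S_neq0 : S !=set0 by exists (vec 1 0 0); rewrite /S /= sqE; ring.
have [t tS tmin] := EVT_min_rV S_neq0 S_compact (continuous_subspaceT q_cont).
pose m := q t; exists m.
have shiftE u v w : form3 (a - m) (b - m) (c - m) d e f u v w =
    form3 a b c d e f u v w - m * (u ^+ 2 + v ^+ 2 + w ^+ 2).
  by rewrite /form3; ring.
have psd u v w : 0 <= form3 (a - m) (b - m) (c - m) d e f u v w.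
  rewrite shiftE; set r := u ^+ 2 + v ^+ 2 + w ^+ 2.
  have r_ge0 : 0 <= r by rewrite !addr_ge0 ?sqr_ge0.
  have [r0|r0] := eqVneq r 0.
    have [u0 v0 w0] : [/\ u = 0, v = 0 & w = 0].
      move: r0 => /eqP; rewrite /r !paddr_eq0 ?addr_ge0 ?sqr_ge0 // !sqrf_eq0.
      by move=> /andP[/andP[/eqP-> /eqP->] /eqP->].
    by rewrite r0 u0 v0 w0 /form3 !(expr0n, mulr0, addr0, subr0).
  have s0 : Num.sqrt r != 0 by rewrite sqrtr_eq0 -ltNge lt_neqAle eq_sym r0.
  have sr : Num.sqrt r ^+ 2 = r by rewrite sqr_sqrtr.
  set k := Num.sqrt r in s0 sr.
  have := tmin (vec (u / k) (v / k) (w / k)); rewrite !inE /S /= sqE qE => mle.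
  have {}mle : m <= form3 a b c d e f (u / k) (v / k) (w / k).
    by apply: mle; rewrite !exprMn -!mulrDl -/r -sr exprVn mulfV // expf_neq0.
  have -> : form3 a b c d e f u v w = r * form3 a b c d e f (u / k) (v / k) (w / k).
    by rewrite -sr /form3; field.
  by rewrite (mulrC m) -mulrBr mulr_ge0 // subr_ge0.
split=> //.
have {tS}: sq t = 1 by move: tS; rewrite inE.
rewrite /sq => sq1.
have : form3 (a - m) (b - m) (c - m) d e f (t ord0 o0) (t ord0 o1) (t ord0 o2) = 0.
  by rewrite shiftE sq1 -/(q t) -/m; ring.
move: sq1; move: (t ord0 o0) (t ord0 o1) (t ord0 o2) => x y z xyz1 form0.
move: psd form0; rewrite /form3; move: (a - m) (b - m) (c - m) => A B C psd form0.
have k0 : A * x + d * y + e * z = 0.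
  apply: (@linear_ge0_eq0 _ A) => s; have := psd (x + s) y z.
  move/le_trans; apply; rewrite le_eqVlt; apply/orP; left; apply/eqP.
  by apply: subr0_eq; apply: (etrans _ form0); ring.
have k1 : d * x + B * y + f * z = 0.
  apply: (@linear_ge0_eq0 _ B) => s; have := psd x (y + s) z.
  move/le_trans; apply; rewrite le_eqVlt; apply/orP; left; apply/eqP.
  by apply: subr0_eq; apply: (etrans _ form0); ring.
have k2 : e * x + f * y + C * z = 0.
  apply: (@linear_ge0_eq0 _ C) => s; have := psd x y (z + s).
  move/le_trans; apply; rewrite le_eqVlt; apply/orP; left; apply/eqP.
  by apply: subr0_eq; apply: (etrans _ form0); ring.
(* Each row below is a row of the adjugate matrix. *)
have Dx : det3 A B C d e f * x = 0.
  transitivity ((B * C - f ^+ 2) * (A * x + d * y + e * z) +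
    (e * f - d * C) * (d * x + B * y + f * z) +
    (d * f - e * B) * (e * x + f * y + C * z)).
    by rewrite /det3; ring.
  by rewrite k0 k1 k2; ring.
have Dy : det3 A B C d e f * y = 0.
  transitivity ((e * f - d * C) * (A * x + d * y + e * z) +
    (A * C - e ^+ 2) * (d * x + B * y + f * z) +
    (d * e - A * f) * (e * x + f * y + C * z)).
    by rewrite /det3; ring.
  by rewrite k0 k1 k2; ring.
have Dz : det3 A B C d e f * z = 0.
  transitivity ((d * f - e * B) * (A * x + d * y + e * z) +
    (d * e - A * f) * (d * x + B * y + f * z) +
    (A * B - d ^+ 2) * (e * x + f * y + C * z)).
    by rewrite /det3; ring.
  by rewrite k0 k1 k2; ring.
transitivity (det3 A B C d e f * x * x + det3 A B C d e f * y * y +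
  det3 A B C d e f * z * z).
  by rewrite -!mulrA -!mulrDr -!expr2 xyz1 mulr1.
by rewrite Dx Dy Dz !mul0r !addr0.
Qed.
(** As the first determinant is zero, the second one is
    [k * (k ^+ 2 + k * t + e2)], with [t] the trace and [e2] the sum of the
    principal minors of size 2. *)
Lemma det3_shift a b c d e f k : det3 a b c d e f = 0 ->
  det3 (a + k) (b + k) (c + k) d e f = 0 -> 0 <= k -> 0 < a + b + c ->
  0 <= (a * b - d ^+ 2) + (a * c - e ^+ 2) + (b * c - f ^+ 2) -> k = 0.
Proof.
move=> det0 detk0 k0 tr e2; apply/eqP.
have kE : k * (k ^+ 2 + k * (a + b + c) +
    ((a * b - d ^+ 2) + (a * c - e ^+ 2) + (b * c - f ^+ 2))) = 0.
  transitivity (det3 (a + k) (b + k) (c + k) d e f - det3 a b c d e f).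
    by rewrite /det3; ring.
  by rewrite detk0 det0 subrr.
move/eqP: kE; rewrite mulf_eq0 => /orP[//|]; apply: contraTT => kn0.
rewrite gt_eqF // ltr_wpDr // ltr_wpDl ?sqr_ge0 // mulr_gt0 // lt_neqAle.
by rewrite eq_sym kn0.
Qed.

End PsdForms.

(** * Complex vectors up to phase and conjugation *)

Local Open Scope complex_scope.
Local Open Scope quotient_scope.

Section GramAlgebra.
Variable R : realType.
Implicit Types (z w : 'rV[R[i]]_3) (i j k l : 'I_3).

(** [re_dot z i j +i* im_dot z i j] is the entry (i, j) of the Hermitian matrix of
    rank one which determines [z] up to a phase. *)
Definition re_dot z i j : R :=
  complex.Re (z ord0 i) * complex.Re (z ord0 j) +
  complex.Im (z ord0 i) * complex.Im (z ord0 j).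

Definition im_dot z i j : R :=
  complex.Im (z ord0 i) * complex.Re (z ord0 j) -
  complex.Re (z ord0 i) * complex.Im (z ord0 j).

(** Linear coordinates of the real part of that matrix modulo the scalar matrices. *)
Definition traceless_gram z : 'rV[R]_5 := \row_(j < 5)
  [:: re_dot z o0 o1; re_dot z o0 o2; re_dot z o1 o2;
      re_dot z o0 o0 - re_dot z o1 o1; re_dot z o1 o1 - re_dot z o2 o2]`_j.

Lemma ord3_ind (P : 'I_3 -> Prop) : P o0 -> P o1 -> P o2 -> forall i, P i.
Proof.
by move=> P0 P1 P2 [[|[|[|//]]] i3]; rewrite (bool_irrelevance i3 isT).
Qed.

Lemma re_dotC z i j : re_dot z i j = re_dot z j i.
Proof. by rewrite /re_dot; ring. Qed.

Lemma complexP (u v : R[i]) :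
  complex.Re u = complex.Re v -> complex.Im u = complex.Im v -> u = v.
Proof. by case: u v => [a b] [c d] /= -> ->. Qed.

Lemma traceless_gramZ (l : R[i]) z : traceless_gram (l *: z) =
  (complex.Re l ^+ 2 + complex.Im l ^+ 2) *: traceless_gram z.
Proof.
have dotZ i j : re_dot (l *: z) i j =
    (complex.Re l ^+ 2 + complex.Im l ^+ 2) * re_dot z i j.
  by rewrite /re_dot !mxE; case: l (z _ i) (z _ j) => [a b] [c d] [e f] /=; ring.
apply/rowP => -[[|[|[|[|[|//]]]]] j5]; by rewrite !mxE /= !dotZ // -mulrBr.
Qed.

Lemma traceless_gram_conj z : traceless_gram (map_mx conjc z) = traceless_gram z.
Proof.
have dotC i j : re_dot (map_mx conjc z) i j = re_dot z i j.
  by rewrite /re_dot !mxE; case: (z _ i) (z _ j) => [a b] [c d] /=; ring.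
by apply/rowP => j; rewrite !mxE !dotC.
Qed.

(** The Binet-Cauchy identity: up to signs, the imaginary part is determined by the
    real part. *)
Lemma im_dot_mul z i j k l :
  im_dot z i j * im_dot z k l =
  re_dot z i k * re_dot z j l - re_dot z i l * re_dot z j k.
Proof. by rewrite /im_dot /re_dot; ring. Qed.

Lemma det_re_dot z : det3 (re_dot z o0 o0) (re_dot z o1 o1) (re_dot z o2 o2)
  (re_dot z o0 o1) (re_dot z o0 o2) (re_dot z o1 o2) = 0.
Proof. by rewrite /det3 /re_dot; ring. Qed.

Lemma trace_re_dot z : z != 0 ->
  0 < re_dot z o0 o0 + re_dot z o1 o1 + re_dot z o2 o2.
Proof.
have dot_ge0 i : 0 <= re_dot z i i by rewrite /re_dot -!expr2 addr_ge0 ?sqr_ge0.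
have tr_ge0 : 0 <= re_dot z o0 o0 + re_dot z o1 o1 + re_dot z o2 o2.
  exact: addr_ge0 (addr_ge0 (dot_ge0 _) (dot_ge0 _)) (dot_ge0 _).
move=> z0; rewrite lt0r tr_ge0 andbT; apply: contraNN z0 => /eqP tr0.
have dot0 i : re_dot z i i = 0.
  have := dot_ge0 o0; have := dot_ge0 o1; have := dot_ge0 o2.
  by elim/ord3_ind: i; lra.
apply/eqP/rowP => i; rewrite mxE; apply/complexP => /=; apply/eqP.
  have /eqP := dot0 i; rewrite /re_dot -!expr2 paddr_eq0 ?sqr_ge0 // !sqrf_eq0.
  by case/andP.
have /eqP := dot0 i; rewrite /re_dot -!expr2 paddr_eq0 ?sqr_ge0 // !sqrf_eq0.
by case/andP.
Qed.

(** The real parts of two such matrices are singular, so they cannot differ by a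
    nonzero scalar matrix, by [det3_shift]. *)
Lemma traceless_gram_re_dot z w : z != 0 -> w != 0 ->
  traceless_gram z = traceless_gram w ->
  forall i j, re_dot z i j = re_dot w i j.
Proof.
move=> z0 w0 gram_zw.
have gramE n (n5 : (n < 5)%N) := congr1 (fun v : 'rV_5 => v ord0 (Ordinal n5)) gram_zw.
have := gramE 0%N isT; have := gramE 1%N isT; have := gramE 2%N isT.
have := gramE 3%N isT; have := gramE 4%N isT; rewrite !mxE /= => d12 d01 e12 e02 e01.
pose k := re_dot z o0 o0 - re_dot w o0 o0.
have shift_eq0 u v h : u != 0 -> re_dot v o0 o0 = re_dot u o0 o0 + h ->
    re_dot v o1 o1 = re_dot u o1 o1 + h -> re_dot v o2 o2 = re_dot u o2 o2 + h ->
    re_dot v o0 o1 = re_dot u o0 o1 -> re_dot v o0 o2 = re_dot u o0 o2 ->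
    re_dot v o1 o2 = re_dot u o1 o2 -> 0 <= h -> h = 0.
  move=> u0 v0 v1 v2 v01 v02 v12 h0; apply: (det3_shift (det_re_dot u) _ h0).
  - by rewrite -v0 -v1 -v2 -v01 -v02 -v12; exact: det_re_dot.
  - exact: trace_re_dot.
  have minor i j : re_dot u i i * re_dot u j j - re_dot u i j ^+ 2 =
      im_dot u i j ^+ 2.
    by rewrite /re_dot /im_dot; ring.
  by rewrite !minor !addr_ge0 ?sqr_ge0.
have k0 : k = 0.
  have [kge0|klt0] := lerP 0 k.
    by apply: (shift_eq0 w z) => //; rewrite /k; lra.
  apply: oppr_inj; rewrite oppr0; apply: (shift_eq0 z w) => //;
    by move: klt0; rewrite /k; lra.
move: k0; rewrite /k => k0.
by elim/ord3_ind; elim/ord3_ind; rewrite ?(re_dotC z o1 o0) ?(re_dotC z o2 o0)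
  ?(re_dotC z o2 o1) ?(re_dotC w o1 o0) ?(re_dotC w o2 o0) ?(re_dotC w o2 o1); lra.
Qed.

(** All the products of two entries of the imaginary parts agree, so the imaginary
    parts agree up to a global sign. *)
Lemma im_dot_sign z w : (forall i j, re_dot z i j = re_dot w i j) ->
  (forall i j, im_dot z i j = im_dot w i j) \/
  (forall i j, im_dot z i j = - im_dot w i j).
Proof.
move=> zw; have mulE i j k l :
    im_dot z i j * im_dot z k l = im_dot w i j * im_dot w k l.
  by rewrite !im_dot_mul !zw.
have [[[i j] wij]|all0] := pselect (exists p, im_dot w p.1 p.2 != 0); last first.
  left=> i j; have wij : im_dot w i j = 0.
    by apply/eqP/negPn/negP => wij; apply: all0; exists (i, j).
  by apply/eqP; rewrite wij -sqrf_eq0 expr2 mulE wij mul0r.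
have /eqP := mulE i j i j; rewrite -!expr2 eqf_sqr => /orP[] /eqP ij; [left|right] => k l.
  by apply: (mulfI wij); rewrite -[in LHS]ij.
by apply: (mulfI wij); rewrite mulrN -mulE ij mulNr opprK.
Qed.

(** Any nonzero column of the common Hermitian matrix of rank one is a multiple of
    both vectors. *)
Lemma rank1_hermitian_proportional z w : z != 0 ->
  (forall i j, re_dot z i j = re_dot w i j) ->
  (forall i j, im_dot z i j = im_dot w i j) ->
  exists2 c : R[i], c != 0 & z = c *: w.
Proof.
move=> z0 re im.
have mulE i j : z ord0 i * (z ord0 j)^* = w ord0 i * (w ord0 j)^*.
  have dotE (u : 'rV_3) : u ord0 i * (u ord0 j)^* = re_dot u i j +i* im_dot u i j.
    rewrite /re_dot /im_dot; case: (u _ i) (u _ j) => [a b] [c d].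
    by apply/complexP => /=; ring.
  by rewrite !dotE re im.
have [j zj] : exists j, z ord0 j != 0.
  apply: contrapT => all0; move/negP: z0; apply; apply/eqP/rowP => j; rewrite mxE.
  by apply/eqP/negPn/negP => zj; apply: all0; exists j.
have wj : w ord0 j != 0.
  apply: contraNneq zj => wj; have /eqP := mulE j j.
  by rewrite wj mul0r mulf_eq0 conjc_eq0 orbb.
exists ((w ord0 j)^* / (z ord0 j)^*).
  by rewrite mulf_neq0 ?invr_eq0 ?conjc_eq0.
apply/rowP => i; rewrite mxE mulrAC [_ * w _ _]mulrC -mulE mulfK //.
by rewrite conjc_eq0.
Qed.

(** The opposite sign in [im_dot_sign] is that of the conjugate vector. *)
Lemma traceless_gram_fiber z w : z != 0 -> w != 0 ->
  traceless_gram z = traceless_gram w ->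
  exists2 c : R[i], c != 0 & z = c *: w \/ z = c *: map_mx conjc w.
Proof.
move=> z0 w0 /(traceless_gram_re_dot z0 w0) re; have [im|im] := im_dot_sign re.
  have [c c0 ->] := rank1_hermitian_proportional z0 re im.
  by exists c => //; left.
have [||c c0 ->] := @rank1_hermitian_proportional z (map_mx conjc w) z0;
  last by exists c => //; right.
  by move=> i j; rewrite re /re_dot !mxE; case: (w _ i) (w _ j) => [? ?] [? ?] /=; ring.
by move=> i j; rewrite im /im_dot !mxE; case: (w _ i) (w _ j) => [? ?] [? ?] /=; ring.
Qed.

(** A singular matrix that is scalar is zero. *)
Lemma traceless_gram_neq0 z : z != 0 -> traceless_gram z != 0.
Proof.
move=> z0; apply/eqP => gram0.
have gramE n (n5 : (n < 5)%N) := congr1 (fun v : 'rV_5 => v ord0 (Ordinal n5)) gram0.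
have := gramE 0%N isT; have := gramE 1%N isT; have := gramE 2%N isT.
have := gramE 3%N isT; have := gramE 4%N isT; rewrite !mxE /= => d12 d01 e12 e02 e01.
have := trace_re_dot z0; have := det_re_dot z; rewrite e01 e02 e12 /det3.
have -> : re_dot z o0 o0 = re_dot z o2 o2 by lra.
have -> : re_dot z o1 o1 = re_dot z o2 o2 by lra.
move: (re_dot z o2 o2) => c; rewrite !(mulr0, mul0r, expr0n, subr0, addr0) /=.
by move=> /eqP; rewrite !mulf_eq0 !orbb => /eqP ->; rewrite !addr0 ltxx.
Qed.

(** Every class modulo the scalars contains a singular positive semidefinite matrix,
    which is the real part of a Hermitian matrix of rank one by [psd_gram]. *)
Lemma traceless_gram_surj (v : 'rV[R]_5) : exists z, traceless_gram z = v.
Proof.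
pose v_ n (n5 : (n < 5)%N) := v ord0 (Ordinal n5).
pose e01 := @v_ 0%N isT; pose e02 := @v_ 1%N isT; pose e12 := @v_ 2%N isT.
pose d1 := @v_ 3%N isT; pose d2 := @v_ 4%N isT.
have [m [psd det0]] := least_eigenvalue_shift (d1 + d2) d2 0 e01 e02 e12.
have [x1 [x2 [x3 [y1 [y2 [y3 [[a b c] [d e f]]]]]]]] := psd_gram psd det0.
exists (\row_j [:: x1 +i* y1; x2 +i* y2; x3 +i* y3]`_j).
apply/rowP => -[[|[|[|[|[|//]]]]] j5]; rewrite !mxE /re_dot !mxE /= -?expr2.
- by rewrite d /e01 /v_; congr (v _ _); exact/val_inj.
- by rewrite e /e02 /v_; congr (v _ _); exact/val_inj.
- by rewrite f /e12 /v_; congr (v _ _); exact/val_inj.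
- rewrite a b (_ : Ordinal j5 = Ordinal (isT : (3 < 5)%N)); last exact/val_inj.
  by rewrite -/(v_ _ _) -/d1; ring.
- rewrite b c (_ : Ordinal j5 = Ordinal (isT : (4 < 5)%N)); last exact/val_inj.
  by rewrite -/(v_ _ _) -/d2; ring.
Qed.

End GramAlgebra.

(** * The orbit space is a sphere *)

Section ComplexTopology.
Variable R : realType.

Lemma entry_continuous (T : topologicalType) m n (i : 'I_m) (j : 'I_n) :
  continuous (fun M : 'M[T]_(m, n) => M i j).
Proof.
move=> M A MA; exists (fun k l => if (k == i) && (l == j) then A else setT).
  by move=> k l; case: ifP => [/andP[/eqP-> /eqP->] //|_]; exact: filterT.
by move=> N /(_ i j); rewrite !eqxx.
Qed.

Lemma continuous_at_matrix (S T : topologicalType) m n (f : S -> 'M[T]_(m, n)) s :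
  (forall i j, continuous_at s (fun t => f t i j)) -> continuous_at s f.
Proof.
move=> cf A [P sP PA].
apply: filterS (_ : nbhs s [set t | forall i j, P i j (f t i j)]).
  by move=> t Pt; exact: PA.
apply: filter_forall => i; apply: filter_forall => j; exact: cf.
Qed.

Lemma ball_complexE (z : R[i]) (e : R[i]) w : ball z e w = (`|z - w| < e) :> Prop.
Proof. by rewrite -[ball]/(@ball _ R[i]^o) -ball_normE. Qed.

Lemma Re_continuous : continuous (@complex.Re R : R[i] -> R).
Proof.
move=> z A /nbhs_ballP[e /= e0 eA]; apply/nbhs_ballP; exists e%:C.
  by rewrite /= ltcR.
move=> w; rewrite ball_complexE => zw; apply: eA; rewrite -ball_normE /=.
rewrite -ltcR; apply: le_lt_trans zw; rewrite -raddfB; exact: normc_ge_Re.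
Qed.

Lemma normc_ge_Im (z : R[i]) : `|complex.Im z|%:C <= `|z|.
Proof.
rewrite normc_def lecR -sqrtr_sqr ler_wsqrtr // lerDr; exact: sqr_ge0.
Qed.

Lemma Im_continuous : continuous (@complex.Im R : R[i] -> R).
Proof.
move=> z A /nbhs_ballP[e /= e0 eA]; apply/nbhs_ballP; exists e%:C.
  by rewrite /= ltcR.
move=> w; rewrite ball_complexE => zw; apply: eA; rewrite -ball_normE /=.
rewrite -ltcR; apply: le_lt_trans zw; rewrite -raddfB; exact: normc_ge_Im.
Qed.

Lemma normc_le (a b : R) : `|a +i* b| <= (`|a| + `|b|)%:C.
Proof.
rewrite normc_def lecR /= -[leRHS]ger0_norm ?addr_ge0 // -sqrtr_sqr.
rewrite ler_wsqrtr // sqrrD !real_normK ?num_real //.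
by rewrite lerD2r lerDl mulrn_wge0 // mulr_ge0.
Qed.

Lemma continuous_at_complex (T : topologicalType) (f g : T -> R) t :
  continuous_at t f -> continuous_at t g ->
  continuous_at t (fun s => f s +i* g s : R[i]).
Proof.
move=> cf cg A /nbhs_ballP[[e e'] /= e0 eA].
move: e0; rewrite ltcE /= => /andP[/eqP e'0 e0]; rewrite {}e'0 in eA.
have e2 : 0 < e / 2 by rewrite divr_gt0.
have nf := cf _ (nbhsx_ballx (f t) _ e2).
have ng := cg _ (nbhsx_ballx (g t) _ e2).
suff near_t : \forall s \near t, A (f s +i* g s) by exact: near_t.
have {}nf : \forall s \near t, ball (f t) (e / 2) (f s) := nf.
have {}ng : \forall s \near t, ball (g t) (e / 2) (g s) := ng.
apply: filterS2 nf ng => s; rewrite -!ball_normE /= => fs gs; apply: eA.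
rewrite ball_complexE; apply: (le_lt_trans (normc_le (f t - f s) (g t - g s))).
by rewrite ltcR [e]splitr ltrD.
Qed.

End ComplexTopology.

Section QuotientSphere.
Variable R : realType.

Notation V3 := (@nonzero_vectors R 2).

Lemma nonzero_vec_neq0 (u : V3) : set_val u != 0.
Proof. by have := set_valP u. Qed.

(** The direction of the traceless real part, a point of the sphere of dimension 4. *)
Definition sphere_of_vec (u : V3) : 'rV[R]_5 :=
  `|traceless_gram (set_val u)|^-1 *: traceless_gram (set_val u).

Lemma sphere_of_vec_continuous : continuous sphere_of_vec.
Proof.
have gram_cont : continuous (fun u : V3 => traceless_gram (set_val u)).
  move=> u; apply: continuous_at_matrix => i j.
  have entry k : continuous_at u (fun u : V3 => set_val u ord0 k).
    apply: (@continuous_comp _ _ _ (fun u : V3 => set_val u)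
      (fun M : 'rV[R[i]]_3 => M ord0 k)).
      exact: initial_continuous.
    exact: entry_continuous.
  have re k : continuous_at u (fun u : V3 => complex.Re (set_val u ord0 k)).
    by apply: (continuous_comp (entry k)); exact: Re_continuous.
  have im k : continuous_at u (fun u : V3 => complex.Im (set_val u ord0 k)).
    by apply: (continuous_comp (entry k)); exact: Im_continuous.
  rewrite /traceless_gram; under eq_fun do rewrite mxE.
  have dot k l : continuous_at u (fun u : V3 => re_dot (set_val u) k l).
    by rewrite /re_dot; polynomial_continuous; first [exact: re|exact: im].
  case: j => [[|[|[|[|[|//]]]]] j5].
  - exact: dot.
  - exact: dot.
  - exact: dot.
  - exact: (continuous_atB (dot o0 o0) (dot o1 o1)).
  - exact: (continuous_atB (dot o1 o1) (dot o2 o2)).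
move=> u; apply: (@continuousZ _ _ _ (fun u => `|traceless_gram (set_val u)|^-1)
  (fun u => traceless_gram (set_val u))); last exact: gram_cont.
apply: continuousV.
  by rewrite normr_eq0 traceless_gram_neq0 // nonzero_vec_neq0.
apply: (@continuous_comp _ _ _ (fun u : V3 => traceless_gram (set_val u))
  (fun v => `|v|)).
  exact: gram_cont.
exact: (@norm_continuous _ _ _).
Qed.


Local Notation Q := (quotient_topology {eq_quot orbit_equiv (@conjCPK R 2)}).

Lemma pi_CP_eqP (u v : V3) : \pi_(CP R 2) u = \pi_(CP R 2) v <->
  exists2 l : R[i], l != 0 & set_val v = l *: set_val u.
Proof.
by split=> [/eqmodP/asboolP|] // uv; apply/eqmodP/asboolP.
Qed.

Lemma pi_Q_eqP (x y : CP R 2) : \pi_Q x = \pi_Q y <-> y = x \/ y = conjCP x.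
Proof.
split=> [/eqmodP xy|xy].
  have : orbit_rel (@conjCP R 2) x y by exact: xy.
  by rewrite orbit_relE => /orP[] /eqP; [left|right].
apply/eqmodP; suff : orbit_rel (@conjCP R 2) x y by [].
rewrite orbit_relE.
by case: xy => ->; rewrite eqxx ?orbT.
Qed.

Lemma sphere_of_vec_norm u : `|sphere_of_vec u| = 1.
Proof. by rewrite normalize_norm // traceless_gram_neq0 // nonzero_vec_neq0. Qed.

Lemma sphere_of_vecZ (u v : V3) (l : R[i]) : l != 0 -> set_val v = l *: set_val u ->
  sphere_of_vec v = sphere_of_vec u.
Proof.
move=> l0 vE; rewrite /sphere_of_vec vE traceless_gramZ normrZ.
have r0 : 0 < complex.Re l ^+ 2 + complex.Im l ^+ 2.
  by rewrite -ltcR add_Re2_Im2 exprn_gt0 // normr_gt0.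
rewrite gtr0_norm // scalerA invfM mulrAC mulVf ?mul1r ?gt_eqF //.
Qed.

Lemma sphere_of_vec_conj u : sphere_of_vec (conj_vec u) = sphere_of_vec u.
Proof. by rewrite /sphere_of_vec /= traceless_gram_conj. Qed.

Definition sphere_of_CP (x : CP R 2) := sphere_of_vec (repr x).

Lemma sphere_of_CP_pi u : sphere_of_CP (\pi_(CP R 2) u) = sphere_of_vec u.
Proof.
rewrite /sphere_of_CP; case: piP => v /pi_CP_eqP[l l0 vE]; exact: sphere_of_vecZ vE.
Qed.

Lemma sphere_of_CP_continuous : continuous sphere_of_CP.
Proof.
apply: repr_comp_continuous; first exact: sphere_of_vec_continuous.
by move=> u v /eqP/pi_CP_eqP[l l0 vE]; rewrite (sphere_of_vecZ l0 vE).
Qed.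

Lemma sphere_of_CP_conj x : sphere_of_CP (conjCP x) = sphere_of_CP x.
Proof.
by elim/quotW: x => u; rewrite -pi_conjCP !sphere_of_CP_pi sphere_of_vec_conj.
Qed.

Definition sphere_of_orbit (x : CP2_mod_conj R) := sphere_of_CP (repr (x : Q)).

Lemma sphere_of_orbit_pi u :
  sphere_of_orbit (\pi_Q (\pi_(CP R 2) u)) = sphere_of_vec u.
Proof.
rewrite /sphere_of_orbit; case: piP => x /pi_Q_eqP[] ->.
  exact: sphere_of_CP_pi.
by rewrite sphere_of_CP_conj sphere_of_CP_pi.
Qed.

Lemma sphere_of_orbit_continuous : continuous sphere_of_orbit.
Proof.
apply: (@repr_comp_continuous _ _ _ sphere_of_CP sphere_of_CP_continuous).
move=> x y /eqP/pi_Q_eqP[] ->//.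
by rewrite sphere_of_CP_conj.
Qed.

(** Rescaling one of the two vectors by a real number makes the values of
    [traceless_gram] equal, and [traceless_gram_fiber] applies. *)
Lemma sphere_of_orbit_inj : injective sphere_of_orbit.
Proof.
elim/quotW => x; elim/(@quotW _ (CP R 2)): x => u.
elim/quotW => x; elim/(@quotW _ (CP R 2)): x => v.
rewrite !sphere_of_orbit_pi /sphere_of_vec => uv.
have u0 := nonzero_vec_neq0 u; have v0 := nonzero_vec_neq0 v.
have tu0 := traceless_gram_neq0 u0; have tv0 := traceless_gram_neq0 v0.
pose s := `|traceless_gram (set_val u)| / `|traceless_gram (set_val v)|.
have s0 : 0 < s by rewrite divr_gt0 ?normr_gt0.
have rs0 : (Num.sqrt s)%:C != 0 :> R[i].
  by rewrite eq_complex /= eqxx andbT sqrtr_eq0 -ltNge.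
have gramE : traceless_gram (set_val u) =
    traceless_gram ((Num.sqrt s)%:C *: set_val v).
  rewrite traceless_gramZ /= expr0n addr0 sqr_sqrtr ?ltW // -scalerA -uv scalerA.
  by rewrite divff ?scale1r // normr_eq0.
have [|c c0 uE] := traceless_gram_fiber u0 _ gramE.
  by rewrite scaler_eq0 negb_or rs0.
apply/esym/pi_Q_eqP; case: uE => uE; [left|right; rewrite -pi_conjCP];
  apply/esym/pi_CP_eqP; exists (c * (Num.sqrt s)%:C); rewrite ?mulf_neq0 //.
  by rewrite -scalerA.
rewrite -scalerA uE; congr (_ *: _).
by rewrite map_mxZ; congr (_ *: _); exact: conjc_real.
Qed.

Lemma sphere_of_orbit_norm x : `|sphere_of_orbit x| = 1.
Proof. exact: sphere_of_vec_norm. Qed.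

Lemma sphere_of_orbit_surj (v : 'rV[R]_5) : `|v| = 1 -> exists x, sphere_of_orbit x = v.
Proof.
move=> v1; have [z zv] := traceless_gram_surj v.
have z0 : z \in @nonzero_vectors R 2.
  rewrite inE /nonzero_vectors /=; apply: contra_eqN v1 => /eqP z0.
  rewrite -zv z0 -(scale0r 0) traceless_gramZ /= expr0n addr0 scale0r normr0.
  by rewrite eq_sym oner_eq0.
exists (\pi_Q (\pi_(CP R 2) (exist _ z z0))).
by rewrite sphere_of_orbit_pi /sphere_of_vec /= zv v1 invr1 scale1r.
Qed.

(** The unit sphere of the real space of dimension 6 maps onto the orbit space. *)
Lemma CP2_mod_conj_compact : compact [set: CP2_mod_conj R].
Proof.
pose cvec (p : 'rV[R]_(3 + 3)) : 'rV[R[i]]_3 :=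
  \row_j (p ord0 (lshift 3 j) +i* p ord0 (rshift 3 j)).
have cvec_cont : continuous cvec.
  move=> p; apply: continuous_at_matrix => i j.
  rewrite /cvec; under eq_fun do rewrite mxE.
  by apply: continuous_at_complex; exact: (@coord_continuous _ _ _ _ _ p).
have one_neq0 : const_mx 1 \in @nonzero_vectors R 2.
  rewrite inE /nonzero_vectors /=; apply/eqP => /rowP/(_ ord0)/eqP.
  by rewrite !mxE oner_eq0.
pose one : V3 := exist (fun v => v \in @nonzero_vectors R 2) _ one_neq0.
pose h p : V3 := insubd one (cvec p).
pose S := [set p : 'rV[R]_(3 + 3) | `|p| = 1].
have cvec_neq0 p : S p -> cvec p \in @nonzero_vectors R 2.
  move=> p1; rewrite inE /nonzero_vectors /=; apply: contra_eqN p1 => /eqP/rowP c0.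
  suff -> : p = 0 by rewrite normr0 eq_sym oner_eq0.
  apply/rowP => k; rewrite mxE -(fintype.splitK k); case: (fintype.split k) => j /=.
    by have := c0 j; rewrite !mxE => -[].
  by have := c0 j; rewrite !mxE => -[].
have hE p : S p -> set_val (h p) = cvec p.
  by move=> /cvec_neq0 pS; rewrite /h; exact: insubdK.
have S_compact : compact S.
  apply: (subclosed_compact _ (@compact_unit_cube R (3 + 3))).
    have closed1 : closed [set 1 : R].
      by apply/accessible_closed_set1/hausdorff_accessible/Rhausdorff.
    have /continuous_closedP := @norm_continuous R 'rV[R]_(3 + 3).
    by move=> /(_ _ closed1).
  by move=> p /= ->.
have h_cont : {within S, continuous h}.
  apply: continuous_comp_initial.
  apply: (@subspace_eq_continuous _ S _ cvec).
    by move=> p; rewrite inE => /hE.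
  exact: continuous_subspaceT.
pose pi_orbit (u : V3) : CP2_mod_conj R := \pi_Q (\pi_(CP R 2) u).
have pi_cont : continuous pi_orbit.
  move=> u; apply: (@continuous_comp _ _ _ (\pi_(CP R 2)) (\pi_Q));
    exact: pi_continuous.
have -> : [set: CP2_mod_conj R] = (fun p => pi_orbit (h p)) @` S.
  apply/seteqP; split=> // + _; elim/quotW => x.
  elim/(@quotW _ (CP R 2)): x => u.
  have u0 := nonzero_vec_neq0 u.
  pose q : 'rV[R]_(3 + 3) :=
    row_mx (map_mx (@complex.Re R) (set_val u)) (map_mx (@complex.Im R) (set_val u)).
  have qE : cvec q = set_val u.
    apply/rowP => j; rewrite mxE row_mxEl row_mxEr !mxE; exact: complexP.
  have q0 : q != 0.
    apply: contraNneq u0 => q0; rewrite -qE q0; apply/eqP/rowP => j.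
    by rewrite !mxE; exact: complexP.
  have qS : S (`|q|^-1 *: q) by exact: normalize_norm.
  exists (`|q|^-1 *: q) => //; congr (\pi_Q _); apply/esym/pi_CP_eqP.
  exists (`|q|^-1)%:C.
    by rewrite eq_complex /= eqxx andbT invr_eq0 normr_eq0.
  rewrite hE // -qE; apply/rowP => j; rewrite !mxE.
  by apply: complexP => /=; ring.
apply: continuous_compact => //.
move=> p; apply: (@continuous_comp _ _ _ (h : subspace S -> V3) pi_orbit).
  exact: h_cont.
exact: pi_cont.
Qed.

End QuotientSphere.

Theorem theorem5p1 (R : realType) : LScat R (CP2_mod_conj R) = Some 2%N.
Proof.
apply: (LScat_topological_sphere (@CP2_mod_conj_compact R)
  (@sphere_of_orbit_continuous R)).
- exact: sphere_of_orbit_norm.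
- exact: sphere_of_orbit_inj.
- exact: sphere_of_orbit_surj.
Qed.
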